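(* Let $(\Omega,T)$ be a minimal subshift over the finite alphabet $A$ with associated set of finite words $\mathcal{W}=\bigcup_{\omega\in\Omega}\mathrm{Sub}(\omega)$. Then the following are equivalent: (i) $(\Omega,T)$ is uniquely ergodic, i.e. the limit $\lim_{|w|\to\infty,\,w\in\mathcal{W}} \frac{\sharp_v(w)}{|w|}$ exists for all $v\in\mathcal{W}$. (ii) For every Banach space $B$ and every additive function $F:\mathcal{W}\to B$, the limit $\lim_{|w|\to\infty,\,w\in\mathcal{W}}\frac{F(w)}{|w|}$ exists in $B$. (iii) For every Banach space $B$ and every continuous function $f:\Omega\to B$, the limit $\lim_{n\to\infty}\frac1n\sum_{j=1}^n f(T^j\omega)$ exists uniformly in $\omega\in\Omega$.
   Context: Let $A$ be a finite set (the alphabet) with the discrete topology, give $A^{\mathbb{Z}}$ the product topology, and let $T:A^{\mathbb{Z}}\to A^{\mathbb{Z}}$, $(Ta)(n)=a(n+1)$, be the shift. A subshift $(\Omega,T)$ over $A$ is a nonempty closed subset $\Omega\subseteq A^{\mathbb{Z}}$ invariant under $T$ ($T(\Omega)=\Omega$). It is minimal if every orbit $\{T^n\omega : n\in\mathbb{Z}\}$, $\omega\in\Omega$, is dense in $\Omega$. $\mathrm{Sub}(\omega)$ denotes the set of finite subwords (factors, i.e. blocks of consecutive letters, including the empty word) of $\omega$. $|w|$ is the length of a finite word $w$, and $\sharp_v(w)$ is the number of (possibly overlapping) occurrences of the word $v$ in the word $w$. A limit $\lim_{|w|\to\infty}G(w)$ for $G$ defined on $\mathcal{W}$ (at least on its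 nonempty words) equals $g$ if for every $\varepsilon>0$ there is $L$ such that $G(w)$ is within $\varepsilon$ of $g$ for all $w\in\mathcal{W}$ with $|w|\ge L$. Additive function: let $(B,|\cdot|)$ be a Banach space. A function $F:\mathcal{W}\to B$ is called additive if there exist a constant $D>0$ and a nonincreasing function $c:[0,\infty)\to[0,\infty)$ with $\lim_{r\to\infty}c(r)=0$ such that (A1) $\left|F(v)-\sum_{j=1}^n F(v_j)\right|\le\sum_{j=1}^n c(|v_j|)\,|v_j|$ whenever $v=v_1\ldots v_n\in\mathcal{W}$ (concatenation of words $v_1,\dots,v_n$); (A2) $|F(v)|\le D|v|$ for every $v\in\mathcal{W}$. *)

(* Defs.v *)
From mathcomp Require Import all_boot all_order all_algebra.
From mathcomp Require Import all_classical all_reals all_analysis.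

Set Implicit Arguments.
Unset Strict Implicit.
Unset Printing Implicit Defensive.

Import Order.TTheory GRing.Theory Num.Theory numFieldNormedType.Exports.

Local Open Scope classical_set_scope.
Local Open Scope ring_scope.

Notation biseq A := {ptws int -> discrete_topology A}.

Section Subshifts.
Variable A : finType.

(* [bishift k] is the [k]-th power of the shift map [T = bishift 1]. *)
Definition bishift (k : int) (a : biseq A) : biseq A := fun n => a (n + k).

Lemma bishift0 : bishift 0 = id.
Proof. by apply/funext => a; apply/funext => n; rewrite /bishift addr0. Qed.

Lemma bishiftD (k l : int) : bishift (k + l) = bishift k \o bishift l.
Proof.
by apply/funext => a; apply/funext => n; rewrite /bishift /= addrA.
Qed.

Lemma iter_bishift1 (n : nat) : iter n (bishift 1) = bishift n%:Z.
Proof.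
by elim: n => [|n IHn]; rewrite ?bishift0 // intS bishiftD -IHn.
Qed.

Definition subshift (Omega : set (biseq A)) : Prop :=
  [/\ Omega !=set0, closed Omega & bishift 1 @` Omega = Omega].

Definition bishift_orbit (a : biseq A) : set (biseq A) :=
  [set bishift k a | k in [set: int]].

Definition minimal_subshift (Omega : set (biseq A)) : Prop :=
  subshift Omega /\
  forall omega, Omega omega -> Omega `<=` closure (bishift_orbit omega).

Definition subwords (a : biseq A) : set (seq A) :=
  [set w | exists (m : int) (k : nat), w = mkseq (fun i => a (m + i%:Z)) k].

Definition words (Omega : set (biseq A)) : set (seq A) :=
  \bigcup_(omega in Omega) subwords omega.

End Subshifts.

Section Words.
Variable A : eqType.

(* Positions range over [0, size w], so the empty word occurs [size w + 1]
   times in [w]. *)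
Definition occ (v w : seq A) : nat :=
  count (fun i => prefix v (drop i w)) (iota 0 (size w).+1).

(* The filter of the limits for [w] in [W] and [size w] tending to infinity. *)
Definition word_infty (W : set (seq A)) : set_system (seq A) :=
  filter_from [set: nat] (fun L => [set w | W w /\ (L <= size w)%N]).

(* [F] and [c] are only constrained on [W] and on [0, +oo[; their values
   elsewhere are irrelevant. *)
Definition additive_function (R : realType) (B : completeNormedModType R)
    (W : set (seq A)) (F : seq A -> B) : Prop :=
  exists (D : R) (c : R -> R),
    [/\ 0 < D,
        (forall r, 0 <= r -> 0 <= c r),
        (forall r s, 0 <= r -> r <= s -> c s <= c r) &
        c r @[r --> +oo] --> (0 : R)] /\
    [/\ (forall vs : seq (seq A), W (flatten vs) ->
           `|F (flatten vs) - \sum_(u <- vs) F u|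
             <= \sum_(u <- vs) c (size u)%:R * (size u)%:R) &
        (forall v, W v -> `|F v| <= D * (size v)%:R)].

End Words.

(* Main.v *)
Require Import Defs.
From mathcomp Require Import all_boot all_order all_algebra.
From mathcomp Require Import all_classical all_reals all_analysis.
From mathcomp Require Import zify ring lra.

Import Order.TTheory GRing.Theory Num.Theory numFieldNormedType.Exports.

Local Open Scope classical_set_scope.
Local Open Scope ring_scope.

(** All three conditions say that averages over long words converge, and they
    are linked by sums over the windows of a word: window_sum n phi w adds up
    phi over the factors of length n of w, one for each starting position.  Such
    a sum is a linear combination of the counts occ v w with v of length n.

    From frequencies to additive functions.  Cut a long word w into blocks of
    length n, starting at each of the n possible offsets.  Additivity compares
    F w with the sum of F over the blocks, with an error of order c(n) |w|.
    Adding up the n comparisons turns the blocks into all windows of w, so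
    F w / |w| is within c(n) + o(1) of the average over windows
    (1/n) sum_v (occ v w / |w|) F v, which converges by hypothesis
    (additive_occ, additive_cvg).

    From additive functions to Birkhoff averages.  The subshift is compact, so
    a continuous f is within e of a function phi of the window of length 2m+1
    around the origin (local_approx).  The Birkhoff sum of f at a is then close
    to window_sum (2m+1) phi evaluated at a long block of a, and window sums of
    a bounded phi are additive (additive_window_sum).  Hence the Birkhoff
    averages of f are uniformly within 2e of a convergent family.

    Both steps end in the same way: in a complete space, a function that is
    approximated to any accuracy by convergent ones converges
    (cvg_uniform_approx).

    From Birkhoff averages to frequencies.  Apply the hypothesis to the
    indicator of the cylinder of v; its Birkhoff sums count the occurrences of v
    up to a boundary term.  The uniform limit g is invariant under the shift,
    and by minimality every finite stretch of a point of the subshift occurs in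
    every orbit, so that g is constant (uniform_limit_const).  Every long word
    w is read along some point, hence occ v w / |w| is close to that
    constant. *)

(** * Two tools for limits of averages *)

(** The limits of the approximants form a Cauchy family, so the limit need not
    be known in advance. *)
Lemma cvg_uniform_approx (R : realType) (B : completeNormedModType R)
    (T : Type) (F : set_system T) (h : T -> B) :
  ProperFilter F ->
  (forall e : R, 0 < e -> exists2 h' : T -> B, cvg (h' x @[x --> F]) &
     \forall x \near F, `|h x - h' x| <= e) ->
  cvg (h x @[x --> F]).
Proof.
move=> FF approx; apply: cauchy_cvg; apply: cauchy_exP => e e0.
have e30 : 0 < e / 3 by lra.
have [h' cvgh' hh'] := approx _ e30.
exists (lim (h' x @[x --> F])).
have /cvgrPdist_lt/(_ _ e30) lim_h' : h' x @[x --> F] --> lim (h' x @[x --> F]).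
  exact: cvgh'.
rewrite /nbhs /=.
near=> x; rewrite -ball_normE /ball_ /=.
have := ler_distD (h' x) (lim (h' x @[x --> F])) (h x).
have : `|h x - h' x| <= e / 3 by near: x.
have : `|lim (h' x @[x --> F]) - h' x| < e / 3 by near: x.
rewrite (distrC (h' x)); lra.
Unshelve. all: by end_near.
Qed.

(** In a sum over the positions of a word of length N, only the last n windows
    of length n are truncated; these get the crude bound y. *)
Lemma ler_sum_boundary (R : numDomainType) (a : nat -> R) (n N : nat) (x y : R) :
  0 <= x -> 0 <= y ->
  (forall i, (i + n <= N)%N -> a i <= x) ->
  (forall i, (i < N)%N -> a i <= y) ->
  \sum_(0 <= i < N) a i <= x * N%:R + y * n%:R.
Proof.
move=> x0 y0 ax ay.
have leN : (N - n <= N)%N by exact: leq_subr.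
rewrite (big_cat_nat (leq0n _) leN) /=; apply: lerD.
  apply: (@le_trans _ _ (\sum_(0 <= i < N - n) x)).
    by rewrite !big_nat; apply: ler_sum => i /andP[_ iN]; apply: ax; lia.
  rewrite sumr_const_nat subn0 -[leLHS]mulr_natr ler_wpM2l// ler_nat; lia.
apply: (@le_trans _ _ (\sum_(N - n <= i < N) y)).
  by rewrite !big_nat; apply: ler_sum => i /andP[_ iN]; apply: ay; lia.
rewrite sumr_const_nat -[leLHS]mulr_natr ler_wpM2l// ler_nat; lia.
Qed.

(** * The topology of the space of bi-infinite sequences *)

(** The cylinders [agree m a] form a basis of neighbourhoods of [a]. *)
Definition agree {A : finType} (m : nat) (a b : biseq A) : Prop :=
  forall k : int, (`|k| <= m)%N -> a k = b k.

Section Topo.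
Variable A : finType.

Lemma near_agree (m : nat) (a : biseq A) : \forall b \near a, agree m a b.
Proof.
have coord (k : int) : \forall b \near a, a k = b k.
  have near_k : nbhs a [set b : biseq A | b k = a k] :=
    @proj_continuous _ (fun _ : int => discrete_topology A) k a _
      (@discrete_set1 (discrete_topology A) _).
  by apply: (@filterS _ _ (nbhs_filter a) _ _ _ near_k) => b.
elim: m => [|m IH].
  apply: (@filterS _ _ (nbhs_filter a) _ _ _ (coord 0)) => b ab k k0.
  by have -> : k = 0 by lia.
apply: (@filterS3 _ _ (nbhs_filter a) _ _ _ _ _ IH
  (coord m.+1%:Z) (coord (- m.+1%:Z))) => b abm abr abl k km.
have [k_le|k_gt] := leqP `|k| m; first exact: abm.
by have [->|->] : k = m.+1%:Z \/ k = - m.+1%:Z by lia.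
Qed.

Lemma nbhs_agree (a : biseq A) (U : set (biseq A)) :
  nbhs a U -> exists m, agree m a `<=` U.
Proof.
pose F : set_system (biseq A) := filter_from setT (fun m => agree m a).
have FF : Filter F.
  apply: filter_from_filter; first by exists 0%N.
  move=> i j _ _; exists (maxn i j) => // b ab; split => k kle; apply: ab; lia.
(* A filter converges in the product as soon as its coordinates do, and the
   k-th coordinate is constant on the cylinder of radius |k|. *)
suff : F --> a by move=> /[apply] -[m _ ?]; exists m.
apply/cvg_sup => k U' [_ [[V _ <-] Va] VU'].
exists `|k|%N => // b ab; apply: VU'.
have ab_k : a k = b k by exact: ab.
by move: Va; rewrite /preimage /= ab_k.
Qed.

Lemma closed_compact_biseq (Om : set (biseq A)) : closed Om -> compact Om.
Proof.
move=> /subclosed_compact; apply; last first.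
  by move=> a _; exact: (I : [set: biseq A] a).
have finA : finite_set [set: discrete_topology A] := @finite_finset A setT.
have := @tychonoff int (fun=> discrete_topology A) (fun=> setT)
  (fun=> finite_compact finA).
by congr compact; apply/seteqP; split.
Qed.

(** Uniform continuity on a compact set, with the cylinders as entourages. *)
Lemma continuous_agree_uniform (R : realType) (B : normedModType R)
    (Om : set (biseq A)) (f : biseq A -> B) :
  closed Om -> {within Om, continuous f} -> forall e : R, 0 < e ->
  exists m, forall a b, Om a -> Om b -> agree m a b -> `|f a - f b| <= e.
Proof.
move=> cOm /subspace_continuousP fcont e e0.
have e20 : 0 < e / 2 by lra.
have /compact_near_coveringP/(_ _ \oo (fun m a => Om a ->
    forall b, Om b -> agree m a b -> `|f a - f b| <= e)) :=
  closed_compact_biseq _ cOm.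
case=> [a Oma|m _ Hm].
  have /cvgr_dist_lt/(_ _ e20) := fcont a Oma.
  rewrite near_withinE => /nbhs_agree[m Hm].
  exists (agree m a, [set m' | (m <= m')%N]) => /=.
    by split; [exact: near_agree|exists m].
  case=> a' m' /= [aa' mm'] Oma' b Omb a'b.
  have ab : agree m a b by move=> k km; rewrite aa'// a'b//; lia.
  have := ler_distD (f a) (f a') (f b).
  have := Hm a' aa' Oma'; have := Hm b ab Omb.
  rewrite /from_subspace (distrC (f a') (f a)); lra.
by exists m => a b Oma Omb; apply: (Hm m) => //=.
Qed.

End Topo.

(** * Sums over the windows of a word *)

(** Near the end of the word the window is truncated. *)
Definition window {A : Type} (n : nat) (w : seq A) (i : nat) : seq A :=
  take n (drop i w).

(** Truncated windows are included, so that the sum over u ++ v differs from the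
    sum over u and the sum over v only in the windows that straddle the cut. *)
Definition window_sum {R : realType} {B : normedModType R} {A : Type}
    (n : nat) (phi : seq A -> B) (w : seq A) : B :=
  \sum_(0 <= i < size w) phi (window n w i).

Section WindowSum.
Variables (R : realType) (B : normedModType R).

Lemma size_window (A : Type) n (w : seq A) i :
  size (window n w i) = minn n (size w - i).
Proof. by rewrite size_take_min size_drop. Qed.

Lemma window_cat_right (A : Type) n (u v : seq A) i :
  window n (u ++ v) (size u + i) = window n v i.
Proof. by rewrite /window addnC -drop_drop drop_size_cat. Qed.

Lemma window_cat_left (A : Type) n (u v : seq A) i : (i + n <= size u)%N ->
  window n (u ++ v) i = window n u i.
Proof.
move=> iu; rewrite /window drop_cat; case: ltnP => [_|ui].
  by rewrite takel_cat// size_drop; lia.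
have n0 : n = 0%N by lia.
by rewrite n0 !take0.
Qed.

Lemma window_sum_cat (A : Type) n (phi : seq A -> B) (C : R) (u v : seq A) :
  (forall w, `|phi w| <= C) ->
  `|window_sum n phi (u ++ v) - (window_sum n phi u + window_sum n phi v)|
    <= 2 * C * n%:R.
Proof.
move=> phiC; have C0 : 0 <= C := le_trans (normr_ge0 _) (phiC [::]).
rewrite /window_sum size_cat (big_cat_nat (leq0n _) (leq_addr (size v) _)) /=.
have -> : \sum_(size u <= i < size u + size v) phi (window n (u ++ v) i) =
    \sum_(0 <= i < size v) phi (window n v i).
  rewrite -{1}[size u]add0n big_addn addKn.
  by apply: eq_bigr => i _; rewrite addnC window_cat_right.
rewrite opprD addrACA subrr addr0 -sumrB.
apply: le_trans (ler_norm_sum _ _ _) _.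
have -> : 2 * C * n%:R = 0 * (size u)%:R + 2 * C * n%:R.
  by rewrite mul0r add0r.
apply: ler_sum_boundary => // [|i iu|i _].
- by rewrite mulr_ge0.
- by rewrite window_cat_left// subrr normr0.
- by rewrite (le_trans (ler_normB _ _))// mulr_natl mulr2n lerD.
Qed.

(** Empty words cost nothing: this matters because an additive function may only
    charge c(|u|) |u| for a piece u. *)
Lemma window_sum_flatten (A : Type) n (phi : seq A -> B) (C : R)
    (vs : seq (seq A)) :
  (forall w, `|phi w| <= C) ->
  `|window_sum n phi (flatten vs) - \sum_(u <- vs) window_sum n phi u|
    <= \sum_(u <- vs) (0 < size u)%N%:R * (2 * C * n%:R).
Proof.
move=> phiC; have C0 : 0 <= C := le_trans (normr_ge0 _) (phiC [::]).
elim: vs => [|u vs IH] /=.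
  by rewrite !big_nil /window_sum big_geq// subrr normr0.
rewrite !big_cons; case: (posnP (size u)) => [/size0nil ->|u0].
  by rewrite /= mul0r add0r {2}/window_sum big_geq// add0r.
rewrite mul1r.
set s := \sum_(j <- vs) _ in IH *.
rewrite (_ : _ - _ = (window_sum n phi (u ++ flatten vs) -
  (window_sum n phi u + window_sum n phi (flatten vs))) +
  (window_sum n phi (flatten vs) - s)).
  apply: le_trans (ler_normD _ _) (lerD _ IH); exact: window_sum_cat.
by rewrite !opprD !addrA subrK.
Qed.

End WindowSum.

(** Each nonempty piece u contributes a bounded boundary error K, which is
    c(|u|) |u| for c(r) = K / max(1, r). *)
Lemma additive_window_sum (R : realType) (B : completeNormedModType R)
    (A : eqType) n (phi : seq A -> B) (C : R) (W : set (seq A)) :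
  (forall w, `|phi w| <= C) -> additive_function W (window_sum n phi).
Proof.
move=> phiC; have C0 : 0 <= C := le_trans (normr_ge0 _) (phiC [::]).
pose K := 2 * C * n%:R.
have K0 : 0 <= K by rewrite !mulr_ge0.
have max_gt0 (r : R) : 0 < Num.max 1 r by rewrite lt_max ltr01.
exists (C + 1), (fun r => K / Num.max 1 r); split; split.
- by rewrite ltr_wpDl.
- by move=> r _; rewrite divr_ge0// ltW.
- move=> r s r0 rs; rewrite ler_wpM2l// lef_pV2 ?posrE//.
  by rewrite ge_max !le_max lexx rs orbT.
- apply/cvgrPdist_le => e e0; near=> r.
  rewrite sub0r normrN ger0_norm; last by rewrite divr_ge0// ltW.
  rewrite ler_pdivrMr// mulrC -ler_pdivrMr// le_max; apply/orP; right.
  by near: r; apply: nbhs_pinfty_ge; rewrite num_real.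
- move=> vs _; apply: le_trans (window_sum_flatten _ _ _ _ _ C _ phiC) _.
  apply: ler_sum => u _; case: (posnP (size u)) => [->|u0].
    by rewrite mul0r mulr0.
  have u1 : (size u)%:R != 0 :> R by rewrite pnatr_eq0; lia.
  by rewrite mul1r max_r ?ler1n// divfK.
- move=> v _; apply: le_trans (ler_norm_sum _ _ _) _.
  apply: (@le_trans _ _ (\sum_(0 <= i < size v) (C + 1))).
    by apply: ler_sum => i _; apply: le_trans (phiC _) _; lra.
  by rewrite sumr_const_nat subn0 mulr_natr.
Unshelve. all: by end_near.
Qed.

Lemma occE (A : eqType) (v w : seq A) :
  occ v w = (\sum_(0 <= i < (size w).+1) (window (size v) w i == v))%N.
Proof.
rewrite /occ -sum1_count big_mkcond /index_iota subn0; apply: eq_bigr => i _.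
by rewrite prefixE; case: eqP.
Qed.

(** The windows of w, grouped by their value. *)
Lemma sum_occ (R : realType) (B : normedModType R) (A : finType) n
    (F : seq A -> B) (w : seq A) :
  (0 < n)%N ->
  \sum_(v : n.-tuple A) (occ v w)%:R *: F v =
  \sum_(0 <= i < size w) (size (window n w i) == n)%:R *: F (window n w i).
Proof.
move=> n0.
under eq_bigr do rewrite occE natr_sum scaler_suml size_tuple.
(* The position [size w], at which only the empty word occurs, is dropped. *)
rewrite exchange_big /= big_nat_recr//= [X in _ + X]big1 ?addr0 => [|v _];
  last first.
  case: eqP => [/(congr1 size)|_]; last by rewrite scale0r.
  rewrite size_window size_tuple subnn minn0 => n_eq0.
  by rewrite -n_eq0 in n0.
apply: eq_bigr => i _.
case: eqP => [/eqP wn|/eqP wn]; last first.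
  rewrite scale0r big1// => v _; case: eqP => [wv|_]; last by rewrite scale0r.
  by rewrite wv size_tuple eqxx in wn.
rewrite (bigD1 (Tuple wn)) //= eqxx big1 ?addr0// => v vw.
case: eqP => [wv|_]; last by rewrite scale0r.
by case/eqP: vw; apply: val_inj.
Qed.
(** * Additive functions as averages over windows *)

Lemma flatten_windows (A : Type) (n J : nat) (s : seq A) :
  flatten (mkseq (fun j => window n s (j * n)) J) = take (J * n) s.
Proof.
elim: J => [|J IH]; first by rewrite mul0n take0.
by rewrite mkseqS flatten_rcons IH mulSn addnC takeD.
Qed.

Lemma sum_offsets (V : nmodType) (n J : nat) (g : nat -> V) :
  \sum_(0 <= k < n) \sum_(0 <= j < J) g (k + j * n)%N =
  \sum_(0 <= i < J * n) g i.
Proof.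
rewrite exchange_big /=; elim: J => [|J IH]; first by rewrite !big_geq.
rewrite big_nat_recr//= IH [in RHS](@big_cat_nat _ _ _ (J * n)) ?leq_mul//=.
congr (_ + _); rewrite -{2}[(J * n)%N]add0n big_addn.
by have -> : (J.+1 * n - J * n = n)%N by rewrite mulSn addnK.
Qed.

Section Average.
Variables (R : realType) (B : completeNormedModType R) (A : finType).
Variables (W : set (seq A)) (F : seq A -> B) (D : R) (c : R -> R).
Hypothesis W_factor : forall w i n, W w -> W (window n w i).
Hypothesis D0 : 0 < D.
Hypothesis c_ge0 : forall r, 0 <= r -> 0 <= c r.
Hypothesis c_noninc : forall r s, 0 <= r -> r <= s -> c s <= c r.
Hypothesis F_add : forall vs : seq (seq A), W (flatten vs) ->
           `|F (flatten vs) - \sum_(u <- vs) F u|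
             <= \sum_(u <- vs) c (size u)%:R * (size u)%:R.
Hypothesis F_lin : forall v, W v -> `|F v| <= D * (size v)%:R.

Lemma additive_nil w : W w -> F [::] = 0.
Proof.
move=> Ww; apply/eqP; rewrite -normr_le0.
by have /F_lin := W_factor w 0 0 Ww; rewrite /window take0 mulr0.
Qed.

(** One cut of w: a prefix of length k, then consecutive blocks of length n.
    Cutting size w blocks always exhausts w; the blocks past the end are empty
    and contribute nothing. *)
Lemma additive_offset (n k : nat) w : (0 < n)%N -> W w ->
  `|F w - (F (take k w) + \sum_(0 <= j < size w) F (window n w (k + j * n)))| <=
  c (size (take k w))%:R * (size (take k w))%:R +
  \sum_(0 <= j < size w) c (size (window n w (k + j * n)))%:R *
    (size (window n w (k + j * n)))%:R.
Proof.
move=> n0 Ww.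
pose vs := take k w :: mkseq (fun j => window n (drop k w) (j * n)) (size w).
have w_vs : flatten vs = w.
  rewrite /= flatten_windows [X in _ ++ X]take_oversize ?cat_take_drop//.
  rewrite size_drop.
  by rewrite (leq_trans (leq_subr _ _))// leq_pmulr.
have := F_add vs; rewrite w_vs => /(_ Ww).
rewrite !big_cons !big_map /index_iota subn0 /window.
under eq_bigr do rewrite drop_drop addnC.
by under [X in _ <= _ + X -> _]eq_bigr do rewrite drop_drop addnC.
Qed.

(** The sum of the n cuts of w.  The blocks starting at k, k + n, k + 2n and so
    on, for k < n, are exactly the windows of w. *)
Lemma additive_window_average (n : nat) w : (0 < n)%N -> W w ->
  `|F w *+ n - window_sum n F w| <=
  (c n%:R * (size w)%:R + (2 * c 0 + D) * n%:R) * n%:R.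
Proof.
move=> n0 Ww.
have c_le0 m : c m%:R <= c 0 by apply: c_noninc.
have cw_le u : (size u <= n)%N -> c (size u)%:R * (size u)%:R <= c 0 * n%:R.
  by move=> un; apply: ler_pM; rewrite ?c_ge0// ler_nat.
have past_end (V : nmodType) (g : seq A -> V) : g [::] = 0 ->
    \sum_(0 <= k < n) \sum_(0 <= j < size w) g (window n w (k + j * n)) =
    \sum_(0 <= i < size w) g (window n w i).
  move=> g0; rewrite (sum_offsets _ _ _ (fun i => g (window n w i))).
  have Nn : (size w <= size w * n)%N by rewrite leq_pmulr.
  rewrite (big_cat_nat (leq0n _) Nn)/= [X in _ + X = _]big_nat.
  rewrite [X in _ + X]big1 ?addr0// => i /andP[wi _].
  by rewrite /window drop_oversize.
have sumF := past_end _ F (additive_nil _ Ww).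
have sumc := past_end _ (fun u => c (size u)%:R * (size u)%:R) (mulr0 _).
have -> : F w *+ n - window_sum n F w =
   \sum_(0 <= k < n) (F w - (F (take k w) +
      \sum_(0 <= j < size w) F (window n w (k + j * n)))) +
   \sum_(0 <= k < n) F (take k w).
  rewrite sumrB sumr_const_nat subn0 big_split /= sumF.
  by rewrite opprD addrA [RHS]addrAC subrK.
have lin_k : `|\sum_(0 <= k < n) F (take k w)| <= D * n%:R * n%:R.
  apply: le_trans (ler_norm_sum _ _ _) _.
  apply: (@le_trans _ _ (\sum_(0 <= k < n) (D * n%:R))).
    rewrite !big_nat; apply: ler_sum => k /andP[_ kn].
    apply: le_trans (F_lin _ _) _; first by rewrite -[w]drop0; exact: W_factor.
    by rewrite ler_pM2l// ler_nat size_take_min; lia.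
  by rewrite sumr_const_nat subn0 [leRHS]mulr_natr.
have add_k : `|\sum_(0 <= k < n) (F w - (F (take k w) +
      \sum_(0 <= j < size w) F (window n w (k + j * n))))| <=
   c 0 * n%:R * n%:R + (c n%:R * n%:R * (size w)%:R + c 0 * n%:R * n%:R).
  apply: le_trans (ler_norm_sum _ _ _) _.
  apply: le_trans (ler_sum _ (fun k _ => additive_offset n k w n0 Ww)) _.
  rewrite big_split/= sumc; apply: lerD.
    apply: (@le_trans _ _ (\sum_(0 <= k < n) (c 0 * n%:R))).
      rewrite !big_nat; apply: ler_sum => k /andP[_ kn].
      by apply: cw_le; rewrite size_take_min; lia.
    by rewrite sumr_const_nat subn0 [leRHS]mulr_natr.
  apply: ler_sum_boundary => [||i iw|i iw].
  - by rewrite mulr_ge0// c_ge0.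
  - by rewrite mulr_ge0// c_ge0.
  - by have -> : size (window n w i) = n by rewrite size_window; lia.
  - by apply: cw_le; rewrite size_window; lia.
apply: le_trans (ler_normD _ _) _; apply: le_trans (lerD add_k lin_k) _.
by rewrite le_eqVlt; apply/orP; left; apply/eqP; ring.
Qed.

(** The truncated windows, which are not counted by occ, are absorbed in the
    boundary term. *)
Lemma additive_occ (n : nat) w : (0 < n)%N -> W w ->
  `|F w *+ n - \sum_(v : n.-tuple A) (occ v w)%:R *: F v| <=
  (c n%:R * (size w)%:R + 2 * (c 0 + D) * n%:R) * n%:R.
Proof.
move=> n0 Ww; rewrite sum_occ//.
have cut : `|window_sum n F w - \sum_(0 <= i < size w)
    (size (window n w i) == n)%:R *: F (window n w i)| <=
    0 * (size w)%:R + D * n%:R * n%:R.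
  rewrite -sumrB; apply: le_trans (ler_norm_sum _ _ _) _.
  have Dn0 : 0 <= D * n%:R by rewrite mulr_ge0// ltW.
  apply: ler_sum_boundary => // [i iw|i _].
    have -> : size (window n w i) = n by rewrite size_window; lia.
    by rewrite eqxx scale1r subrr normr0.
  case: eqP => _; first by rewrite scale1r subrr normr0.
  rewrite scale0r subr0 (le_trans (F_lin _ (W_factor _ _ _ Ww)))//.
  by rewrite ler_pM2l// ler_nat size_window; lia.
have := ler_distD (window_sum n F w) (F w *+ n) (\sum_(0 <= i < size w)
    (size (window n w i) == n)%:R *: F (window n w i)).
have := additive_window_average n w n0 Ww.
move: cut; lra.
Qed.
End Average.

(** * From frequencies to additive functions *)

Definition block {A : finType} (a : biseq A) (s : int) (n : nat) : seq A :=
  mkseq (fun i => a (s + i%:Z)) n.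

Section Blocks.
Variable A : finType.

Lemma window_block (a : biseq A) s N n i :
  window n (block a s N) i = block a (s + i%:Z) (minn n (N - i)).
Proof.
rewrite /window /block /mkseq -map_drop drop_iota -map_take take_iota.
rewrite add0n -[in LHS](addn0 i) iotaDl -map_comp.
by rewrite addn0; apply: eq_map => j /=; rewrite PoszD addrA.
Qed.

Lemma block_bishift k (a : biseq A) s n :
  block (bishift k a) s n = block a (s + k) n.
Proof. by apply: eq_map => i; rewrite /bishift addrAC. Qed.

Lemma words_block (Om : set (biseq A)) a s n : Om a -> words Om (block a s n).
Proof. by exists a => //; exists s, n. Qed.

Lemma words_window (Om : set (biseq A)) w i n :
  words Om w -> words Om (window n w i).
Proof.
move=> [a Oma [s [N ->]]]; rewrite -/(block a s N) window_block.
exact: words_block.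
Qed.

Lemma block_center_agree m (a b : biseq A) :
  block a (- m%:Z) (2 * m).+1 = block b (- m%:Z) (2 * m).+1 -> agree m a b.
Proof.
move=> ab k km.
have := congr1 (nth (a 0) ^~ `|(k + m%:Z)%R|%N) ab.
rewrite !nth_mkseq; try lia.
by have -> : - m%:Z + `|(k + m%:Z)%R|%:Z = k by lia.
Qed.

End Blocks.

Section WordLimits.
Variables (R : realType) (A : finType) (Om : set (biseq A)).
Hypothesis Om0 : Om !=set0.

Lemma word_infty_proper : ProperFilter (word_infty (words Om)).
Proof.
apply: filter_from_proper; last first.
  move=> N _; have [a Oma] := Om0; exists (block a 0 N); split.
    exact: words_block.
  by rewrite size_mkseq.
apply: filter_from_filter; first by exists 0%N.
by move=> i j _ _; exists (maxn i j) => // w [Ww]; rewrite geq_max => /andP[].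
Qed.

Lemma near_word_infty (x : R) :
  \forall w \near word_infty (words Om), words Om w /\ x <= (size w)%:R.
Proof.
have [N _ HN] := nbhs_infty_ger x.
by exists N => // w [Ww Nw]; split => //; exact: HN.
Qed.

(** The sum ranges over all words v of length n; those that are not words of the
    subshift have no occurrences, so their frequencies are 0. *)
Lemma occ_average_cvg (B : completeNormedModType R) n (F : seq A -> B) :
  (forall v : seq A, words Om v ->
     cvg (((occ v w)%:R / (size w)%:R : R) @[w --> word_infty (words Om)])) ->
  cvg ((n%:R^-1 *: \sum_(v : n.-tuple A)
    ((occ v w)%:R / (size w)%:R : R) *: F v) @[w --> word_infty (words Om)]).
Proof.
move=> occ_cvg; have PF := word_infty_proper.
have occ_lim (v : n.-tuple A) : exists l : R,
    ((occ v w)%:R / (size w)%:R : R) @[w --> word_infty (words Om)] --> l.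
  have [Wv|Wv] := pselect (words Om v).
    exists (lim (((occ v w)%:R / (size w)%:R : R)
      @[w --> word_infty (words Om)])).
    exact: occ_cvg.
  exists 0; apply: (@cvg_trans _ ((fun=> 0 : R) @ word_infty (words Om)));
    last exact: cvg_cst.
  apply: near_eq_cvg.
  exists 0%N => // w [Ww _]; rewrite occE big1_seq ?mul0r// => i _.
  case: eqP => // wv; case: Wv; rewrite -wv; exact: words_window.
have [l Hl] := choice occ_lim.
apply: (cvgP (n%:R^-1 *: \sum_(v : n.-tuple A) l v *: F v)).
apply: cvgZl_tmp; apply: cvg_big; first exact: add_continuous.
by move=> v _; apply: cvgZr_tmp; exact: Hl.
Qed.

(** The error of additive_occ, divided by n |w|, is at most c(n) + K / |w| with K
    depending on n only: n makes the first term small, then |w| the second. *)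
Lemma additive_cvg (B : completeNormedModType R) (F : seq A -> B) :
  (forall v : seq A, words Om v ->
     cvg (((occ v w)%:R / (size w)%:R : R) @[w --> word_infty (words Om)])) ->
  additive_function (words Om) F ->
  cvg (((size w)%:R^-1 *: F w) @[w --> word_infty (words Om)]).
Proof.
move=> occ_cvg [D [c [[D0 c_ge0 c_noninc c_lim] [F_add F_lin]]]].
have PF := word_infty_proper.
apply: cvg_uniform_approx => e e0; have e20 : 0 < e / 2 by lra.
have [n n0 cn] : exists2 n, (0 < n)%N & c n%:R <= e / 2.
  have /cvgrPdist_le/(_ _ e20)[x [_ Hx]] := c_lim.
  have [N _ HN] := nbhs_infty_ger (x + 1).
  exists (maxn 1 N); first by rewrite leq_max.
  have := Hx (maxn 1 N)%:R; rewrite sub0r normrN ger0_norm ?c_ge0//; apply.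
  have := HN (maxn 1 N) (leq_maxr _ _) => /=; lra.
exists (fun w => n%:R^-1 *: \sum_(v : n.-tuple A)
    ((occ v w)%:R / (size w)%:R : R) *: F v); first exact: occ_average_cvg.
pose K := 2 * (c 0 + D) * n%:R.
have K0 : 0 <= K by rewrite !mulr_ge0// addr_ge0 ?c_ge0// ltW.
apply: filterS (near_word_infty (1 + K / (e / 2))) => w [Ww w_large].
have w0 : 0 < (size w)%:R :> R.
  by apply: lt_le_trans w_large; rewrite ltr_wpDr// divr_ge0// ltW.
have nR0 : 0 < n%:R :> R by rewrite ltr0n.
have := additive_occ R B A (words Om) F D c
  (fun w i n => @words_window A Om w i n) D0 c_ge0 c_noninc F_add F_lin n w n0 Ww.
have -> : (size w)%:R^-1 *: F w -
   n%:R^-1 *: \sum_(v : n.-tuple A) ((occ v w)%:R / (size w)%:R : R) *: F v =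
   ((size w)%:R * n%:R)^-1 *:
     (F w *+ n - \sum_(v : n.-tuple A) (occ v w)%:R *: F v).
  rewrite scalerBr -[F w *+ n]scaler_nat scalerA; congr (_ *: _ - _).
    by field; rewrite !gt_eqF.
  rewrite !scaler_sumr; apply: eq_bigr => v _; rewrite !scalerA; congr (_ *: _).
  by field; rewrite !gt_eqF.
have wn0 : 0 < ((size w)%:R * n%:R)^-1 :> R by rewrite invr_gt0 mulr_gt0.
rewrite normrZ (gtr0_norm wn0) => /le_trans err.
rewrite mulrC ler_pdivrMr ?mulr_gt0//; apply: err.
rewrite -/K mulrA ler_pM2r//.
have : K <= e / 2 * (size w)%:R.
  by rewrite mulrC -ler_pdivrMr//; move: w_large; lra.
have : c n%:R * (size w)%:R <= e / 2 * (size w)%:R by rewrite ler_pM2r.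
lra.
Qed.

End WordLimits.

(** * From additive functions to Birkhoff averages *)

Section Birkhoff.
Variables (R : realType) (A : finType) (Om : set (biseq A)).
Hypothesis Om0 : Om !=set0.
Hypothesis Om_closed : closed Om.
Hypothesis Om_shift : bishift 1 @` Om = Om.

Lemma bishift_closed (k : int) a : Om a -> Om (bishift k a).
Proof.
have shift1 b : Om b -> Om (bishift 1 b).
  by move=> Omb; rewrite -Om_shift; exists b.
have shiftN1 b : Om b -> Om (bishift (-1) b).
  rewrite -{1}Om_shift => -[c Omc <-].
  rewrite -[bishift _ _]/((bishift (-1) \o bishift 1) c) -bishiftD.
  by rewrite addNr bishift0.
move=> Oma; case: k => n.
  by rewrite -iter_bishift1; elim: n => [//|n IH]; rewrite iterS; exact: shift1.
elim: n => [|n IH]; first exact: shiftN1.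
have -> : Negz n.+1 = -1 + Negz n by lia.
by rewrite bishiftD; exact: shiftN1.
Qed.

(** Convergence to a constant along this filter is convergence as the first
    component tends to infinity, uniformly in the second; it makes uniform
    convergence accessible to cvg_uniform_approx. *)
Definition pair_infty : set_system (nat * biseq A) :=
  filter_from setT (fun N => [set p | (N <= p.1)%N /\ Om p.2]).

Lemma pair_infty_proper : ProperFilter pair_infty.
Proof.
apply: filter_from_proper; last first.
  by move=> N _; have [a Oma] := Om0; exists (N, a).
apply: filter_from_filter; first by exists 0%N.
move=> i j _ _; exists (maxn i j) => // -[N a] /= [+ Oma].
by rewrite geq_max => /andP[].
Qed.

Lemma uniform_cvg_pair (B : completeNormedModType R)
    (h : nat -> biseq A -> B) (l : B) :
  h p.1 p.2 @[p --> pair_infty] --> l ->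
  {uniform Om, h @ \oo --> (cst l : biseq A -> B)}.
Proof.
move=> /cvg_entourageP hl P /uniform_nbhs[E [entE EP]].
have PF := pair_infty_proper.
have [N _ HN] := hl _ E entE.
by exists N => // n /= Nn; apply: EP => a Oma; exact: (HN (n, a)).
Qed.

Section Local.
Variables (B : completeNormedModType R) (f : biseq A -> B).

(** The value phi u is that of f at a chosen point of the cylinder of u, and 0 if
    the cylinder is empty; phi is bounded because there are finitely many
    words u of the given length. *)
Lemma local_approx (e : R) : {within Om, continuous f} -> 0 < e ->
  exists (m : nat) (phi : seq A -> B) (C : R),
    (forall w, `|phi w| <= C) /\
    (forall a, Om a -> `|f a - phi (block a (- m%:Z) (2 * m).+1)| <= e).
Proof.
move=> fcont e0.
have [m Hm] := continuous_agree_uniform _ _ _ _ _ Om_closed fcont _ e0.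
have [a0 _] := Om0.
pose n := (2 * m).+1.
pose cyl u := [set a | Om a /\ block a (- m%:Z) n = u].
pose phi u := if pselect (cyl u !=set0) then f (xget a0 (cyl u)) else 0.
have phi_in u : cyl u !=set0 -> phi u = f (xget a0 (cyl u)).
  by rewrite /phi; case: pselect.
have phi_out u : ~ (cyl u !=set0) -> phi u = 0 by rewrite /phi; case: pselect.
exists m, phi, (\sum_(v : n.-tuple A) `|phi v|); split => [w|a Oma].
  have [[a [_ wa]]|/phi_out ->] := pselect (cyl w !=set0); last first.
    by rewrite normr0 sumr_ge0.
  have wn : size w == n by rewrite -wa size_mkseq.
  by rewrite (bigD1 (Tuple wn)) //= lerDl sumr_ge0.
have ne : cyl (block a (- m%:Z) n) !=set0 by exists a.
rewrite -/n phi_in//.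
have [Omb ab] := xgetPex a0 ne.
by apply: Hm => //; apply: block_center_agree; rewrite ab.
Qed.

(** The block starts at 1 - m because the first term of the Birkhoff sum, at the
    shift of a by 1, sees the coordinates 1 - m to 1 + m of a.  At the last n
    positions the window is truncated and |f| <= C + e is used instead. *)
Lemma birkhoff_window_sum (m : nat) (phi : seq A -> B) (C e : R) (N : nat) a :
  let n := (2 * m).+1 in
  (forall w, `|phi w| <= C) ->
  (forall a, Om a -> `|f a - phi (block a (- m%:Z) n)| <= e) ->
  Om a ->
  `|\sum_(1 <= j < N.+1) f (iter j (bishift 1) a) -
    window_sum n phi (block a (1 - m%:Z) N)|
  <= e * N%:R + (2 * C + e) * n%:R.
Proof.
move=> n phiC f_phi Oma.
have e0 : 0 <= e := le_trans (normr_ge0 _) (f_phi _ Oma).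
have C0 : 0 <= C := le_trans (normr_ge0 _) (phiC [::]).
have iterS_bishift i : iter i.+1 (bishift 1) a = bishift i.+1%:Z a.
  by rewrite iter_bishift1.
rewrite /window_sum size_mkseq big_add1 -sumrB.
apply: le_trans (ler_norm_sum _ _ _) _.
apply: ler_sum_boundary => // [|i iN|i _]; first by rewrite addr_ge0// mulr_ge0.
  rewrite window_block (_ : minn n (N - i) = n); last by lia.
  rewrite iterS_bishift (_ : 1 - m%:Z + i%:Z = - m%:Z + i.+1%:Z); last by lia.
  rewrite -block_bishift; apply: f_phi; exact: bishift_closed.
rewrite iterS_bishift.
have := f_phi _ (bishift_closed i.+1%:Z a Oma).
set b := bishift _ _; set u := block _ _ _; set w := window _ _ _ => fb.
have := ler_normB (f b - phi u + phi u) (phi w).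
rewrite {1}subrK => /le_trans; apply.
have := ler_normD (f b - phi u) (phi u); have := phiC u; have := phiC w; lra.
Qed.

Lemma birkhoff_uniform_cvg :
  (forall F : seq A -> B, additive_function (words Om) F ->
     cvg (((size w)%:R^-1 *: F w) @[w --> word_infty (words Om)])) ->
  {within Om, continuous f} ->
  exists g : biseq A -> B,
    {uniform Om, (fun (n : nat) (omega : biseq A) =>
       n%:R^-1 *: \sum_(1 <= j < n.+1) f (iter j (bishift 1) omega)) @ \oo --> g}.
Proof.
move=> additive_cvg fcont; have PF := pair_infty_proper.
suff h_cvg : cvg (p.1%:R^-1 *: \sum_(1 <= j < p.1.+1) f (iter j (bishift 1) p.2)
    @[p --> pair_infty]).
  eexists; apply: (uniform_cvg_pair B (fun n a =>
    n%:R^-1 *: \sum_(1 <= j < n.+1) f (iter j (bishift 1) a))).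
  exact: h_cvg.
apply: cvg_uniform_approx => e e0; have e20 : 0 < e / 2 by lra.
have [m [phi [C [phiC f_phi]]]] := local_approx _ fcont e20.
pose W (p : nat * biseq A) := block p.2 (1 - m%:Z) p.1.
pose n := (2 * m).+1.
exists (fun p => (size (W p))%:R^-1 *: window_sum n phi (W p)).
  have /cvg_ex[l Hl] :=
    additive_cvg _ (additive_window_sum R B A n phi C (words Om) phiC).
  apply: (cvgP l); apply: (@cvg_comp _ _ _ W _ _ _ _ _ Hl).
  move=> P [N _ NP]; exists N => // p [Np Omp]; apply: NP.
  by split; [exact: words_block|rewrite size_mkseq].
pose K := (2 * C + e / 2) * n%:R.
have [N _ HN] := nbhs_infty_ger (1 + `|K| / (e / 2)).
exists N => // -[k a] /= [Nk Oma]; rewrite size_mkseq.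
rewrite -scalerBr normrZ normfV normr_nat.
have k_large := HN k Nk; rewrite /= in k_large.
have k0 : 0 < k%:R :> R.
  by apply: lt_le_trans k_large; rewrite ltr_wpDr// divr_ge0// ltW.
rewrite mulrC ler_pdivrMr//.
apply: le_trans (birkhoff_window_sum m phi C (e / 2) k a phiC f_phi Oma) _.
have : `|K| <= e / 2 * k%:R.
  by rewrite mulrC -ler_pdivrMr//; move: k_large; lra.
have := ler_norm K; rewrite -/n -/K; lra.
Qed.

End Local.

End Birkhoff.

(** * From Birkhoff averages to frequencies *)

Section Frequencies.
Variables (R : realType) (A : finType) (Om : set (biseq A)) (v : seq A).
Hypothesis Om_minimal : minimal_subshift Om.

Definition cylinder_indicator (a : biseq A) : R^o :=
  (block a 0 (size v) == v)%:R.

Lemma agree_block m (a b : biseq A) (s : int) n : agree m a b ->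
  (`|s| + n <= m)%N -> block a s n = block b s n.
Proof.
move=> ab snm; rewrite /block /mkseq; apply/eq_in_map => i.
by rewrite mem_iota => i_n; apply: ab; lia.
Qed.

Lemma cylinder_indicator_continuous : {within Om, continuous cylinder_indicator}.
Proof.
apply/subspace_continuousP => a _; apply/cvgrPdist_le => e e0.
rewrite near_withinE.
apply: (@filterS _ _ (nbhs_filter a) _ _ _ (near_agree A (size v) a)).
move=> b ab _; rewrite /from_subspace/= /cylinder_indicator.
by rewrite (agree_block _ a b 0 (size v) ab)// subrr normr0 ltW.
Qed.

Definition birkhoff_sum (N : nat) (a : biseq A) : R^o :=
  \sum_(1 <= j < N.+1) cylinder_indicator (iter j (bishift 1) a).

Lemma birkhoff_sum_agree N (a b : biseq A) :
  agree (N + size v) a b -> birkhoff_sum N a = birkhoff_sum N b.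
Proof.
move=> ab; rewrite /birkhoff_sum !big_nat; apply: eq_bigr => j jN.
rewrite iter_bishift1 /cylinder_indicator !block_bishift.
by rewrite (agree_block _ a b _ _ ab)//; lia.
Qed.

(** The two sides differ at the last [size v] positions, where the cylinder looks
    beyond the end of the block, and by the extra position [N] of occ, which
    only counts when v is empty. *)
Lemma birkhoff_sum_occ N (a : biseq A) :
  `|(occ v (block a 1 N))%:R - birkhoff_sum N a| <= (size v).+1%:R.
Proof.
have iterS_bishift i : iter i.+1 (bishift 1) a = bishift i.+1%:Z a.
  by rewrite iter_bishift1.
have size_block n : size (block a 1 n) = n by rewrite size_mkseq.
rewrite occE size_block natr_sum big_nat_recr//= /birkhoff_sum big_add1.
rewrite addrAC -sumrB -[(size v).+1]addn1 natrD.
apply: le_trans (ler_normD _ _) _; apply: lerD; last first.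
  by rewrite normr_nat ler_nat leq_b1.
apply: le_trans (ler_norm_sum _ _ _) _.
have -> : (size v)%:R = 0 * N%:R + 1 * (size v)%:R :> R.
  by rewrite mul0r add0r mul1r.
apply: ler_sum_boundary => // i iN.
  rewrite iterS_bishift window_block.
  rewrite (_ : minn (size v) (N - i) = size v); last by lia.
  by rewrite /cylinder_indicator block_bishift add0r -intS subrr normr0.
rewrite /cylinder_indicator; do 2 case: (_ == v) => /=;
  by rewrite ?subrr ?subr0 ?sub0r ?normrN ?normr0 ?normr1.
Qed.

Lemma uniform_cvg_close (g : biseq A -> R^o) :
  {uniform Om, (fun (n : nat) (a : biseq A) => n%:R^-1 *: birkhoff_sum n a)
     @ \oo --> g} ->
  forall e : R, 0 < e -> exists N0, forall n, (N0 <= n)%N ->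
    forall a, Om a -> `|g a - n%:R^-1 *: birkhoff_sum n a| <= e.
Proof.
move=> g_lim e e0.
have : nbhs (g : {uniform` Om -> R^o})
    [set h | forall a, Om a -> ball (g a) e (h a)].
  by apply/uniform_nbhs; exists [set xy | ball xy.1 e xy.2]; split;
    [exact: (entourage_ball _ (PosNum e0))|].
move=> /g_lim[N0 _ HN0]; exists N0 => n Nn a Oma.
by have := HN0 n Nn a Oma; rewrite -ball_normE /= => /ltW.
Qed.

(** The Birkhoff sums at a and at its shift differ by two terms, so g is constant
    on orbits.  The N-th Birkhoff sum sees finitely many coordinates, and by
    minimality the orbit of b contains a point with the same coordinates as a
    there; hence g a and g b are equal up to any error. *)
Lemma uniform_limit_const (g : biseq A -> R^o) :
  {uniform Om, (fun (n : nat) (a : biseq A) => n%:R^-1 *: birkhoff_sum n a)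
     @ \oo --> g} ->
  forall a b, Om a -> Om b -> g a = g b.
Proof.
have [[Om0 Om_closed Om_shift] Om_dense] := Om_minimal.
move=> g_lim.
have Om_bi (k : int) a : Om a -> Om (bishift k a) :=
  bishift_closed A Om Om_shift k a.
have close := uniform_cvg_close g g_lim.
have small (x : R) : (forall e, 0 < e -> `|x| <= e) -> x = 0.
  move=> xe; apply/eqP; rewrite -normr_le0; apply/ler_addgt0Pr => e e0.
  by rewrite add0r xe.
have shift1 a : Om a -> g (bishift 1 a) = g a.
  move=> Oma; apply/eqP; rewrite -subr_eq0; apply/eqP; apply: small => e e0.
  have e30 : 0 < e / 3 by lra.
  have [N0 HN0] := close _ e30.
  have [N1 _ HN1] := nbhs_infty_ger ((e / 3)^-1).
  pose n := maxn 1 (maxn N0 N1).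
  have ga := HN0 n ltac:(lia) a Oma.
  have gTa := HN0 n ltac:(lia) _ (Om_bi 1 a Oma).
  have n0 : 0 < n%:R :> R by rewrite ltr0n; lia.
  have n_large : (e / 3)^-1 <= n%:R by apply: HN1 => /=; lia.
  have : `|n%:R^-1 *: birkhoff_sum n (bishift 1 a) -
      n%:R^-1 *: birkhoff_sum n a| <= e / 3.
    rewrite -scalerBr normrZ normfV normr_nat mulrC ler_pdivrMr//.
    apply: (@le_trans _ _ 1); last by rewrite mulrC -ler_pdivrMr// div1r.
    rewrite /birkhoff_sum -sumrB.
    under eq_bigr do rewrite -iterSr.
    rewrite (telescope_sumr (fun j =>
      cylinder_indicator (iter j (bishift 1) a)))//.
    rewrite /cylinder_indicator; do 2 case: (_ == v) => /=;
      by rewrite ?subrr ?subr0 ?sub0r ?normrN ?normr0 ?normr1.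
  move: ga gTa.
  set x := n%:R^-1 *: _; set y := n%:R^-1 *: _ => ga gTa xy.
  have -> : g (bishift 1 a) - g a = (g (bishift 1 a) - y) + (y - x) - (g a - x).
    by ring.
  apply: le_trans (ler_normB _ _) _.
  have := ler_normD (g (bishift 1 a) - y) (y - x); lra.
have shift (k : int) a : Om a -> g (bishift k a) = g a.
  have pos (n : nat) b : Om b -> g (bishift n%:Z b) = g b.
    move=> Omb; elim: n => [|n IH]; first by rewrite bishift0.
    by rewrite intS bishiftD /= shift1 ?IH//; exact: Om_bi.
  move=> Oma; have [k0|k0] := leP 0 k.
    have -> : k = `|k|%N%:Z by lia.
    exact: pos.
  rewrite -(pos `|k|%N _ (Om_bi k a Oma)).
  rewrite -[bishift _ (bishift k a)]/((bishift `|k|%N%:Z \o bishift k) a).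
  rewrite -bishiftD.
  by have -> : `|k|%N%:Z + k = 0 by [lia]; rewrite bishift0.
move=> a b Oma Omb; apply/eqP; rewrite -subr_eq0; apply/eqP; apply: small => e e0.
have e20 : 0 < e / 2 by lra.
have [N HN] := close _ e20.
have [_ [[k _ <-] a_agree]] :=
  Om_dense b Omb a Oma _ (near_agree A (N + size v) a).
rewrite -(shift k b Omb).
have ga := HN N (leqnn _) a Oma; have gb := HN N (leqnn _) _ (Om_bi k b Omb).
rewrite -(birkhoff_sum_agree _ _ _ a_agree) in gb.
move: ga gb; set x := _ *: _ => ga gb.
have -> : g a - g (bishift k b) = (g a - x) - (g (bishift k b) - x) by ring.
apply: le_trans (ler_normB _ _) _; lra.
Qed.

(** Every word of the subshift is a block starting at position 1 of some point,
    by shifting the point it is read from. *)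
Lemma occ_frequency_cvg :
  (exists g : biseq A -> R^o,
     {uniform Om, (fun (n : nat) (a : biseq A) => n%:R^-1 *: birkhoff_sum n a)
        @ \oo --> g}) ->
  cvg (((occ v w)%:R / (size w)%:R : R) @[w --> word_infty (words Om)]).
Proof.
have [[Om0 Om_closed Om_shift] _] := Om_minimal.
have PF := word_infty_proper A Om Om0.
move=> [g g_lim]; have [a0 Oma0] := Om0.
apply: (cvgP (g a0)); apply/cvgrPdist_le => e e0.
have e20 : 0 < e / 2 by lra.
have [N0 HN0] := uniform_cvg_close g g_lim _ e20.
apply: filterS
  (near_word_infty R A Om (N0%:R + 1 + (size v).+1%:R / (e / 2))).
move=> w [[a Oma [m [N ->]]]]; rewrite -/(block a m N) size_mkseq => N_large.
pose b := bishift (m - 1) a.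
have Omb : Om b by exact: bishift_closed.
have -> : block a m N = block b 1 N by rewrite block_bishift addrC subrK.
have K0 : 0 <= (size v).+1%:R / (e / 2) :> R by rewrite divr_ge0// ltW.
have N00 : 0 <= N0%:R :> R by [].
have NN : (N0 <= N)%N by rewrite -(ler_nat R); lra.
have NR0 : 0 < N%:R :> R by lra.
have gb := HN0 N NN b Omb; rewrite (uniform_limit_const g g_lim a0 b)//.
have occ_b : `|N%:R^-1 *: birkhoff_sum N b - (occ v (block b 1 N))%:R / N%:R|
    <= e / 2.
  rewrite distrC [X in X - _]mulrC.
  rewrite -[X in X - _]/(N%:R^-1 *: ((occ v (block b 1 N))%:R : R^o)).
  rewrite -scalerBr normrZ normfV normr_nat mulrC ler_pdivrMr//.
  apply: le_trans (birkhoff_sum_occ N b) _.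
  by rewrite mulrC -ler_pdivrMr//; lra.
apply: le_trans (ler_distD (N%:R^-1 *: birkhoff_sum N b) _ _) _; lra.
Qed.

End Frequencies.

Theorem theorem1 (R : realType) (A : finType) (Omega : set (biseq A))
    (Omega_minimal : minimal_subshift Omega) :
  [<-> forall v : seq A, words Omega v ->
         cvg (((occ v w)%:R / (size w)%:R : R) @[w --> word_infty (words Omega)]);
       forall (B : completeNormedModType R) (F : seq A -> B),
         additive_function (words Omega) F ->
         cvg (((size w)%:R^-1 *: F w) @[w --> word_infty (words Omega)]);
       forall (B : completeNormedModType R) (f : biseq A -> B),
         {within Omega, continuous f} ->
         exists g : biseq A -> B,
           {uniform Omega,
             (fun (n : nat) (omega : biseq A) =>
                n%:R^-1 *: \sum_(1 <= j < n.+1) f (iter j (bishift 1) omega))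
             @ \oo --> g}].
Proof.
have [[Om0 Om_closed Om_shift] _] := Omega_minimal.
split; last split.
- by move=> occ_cvg B F; exact: additive_cvg.
- by move=> add_cvg B f; apply: birkhoff_uniform_cvg => // F; exact: add_cvg.
- move=> birkhoff_cvg v _; apply: occ_frequency_cvg => //.
  exact: birkhoff_cvg (cylinder_indicator_continuous R A Omega v).
Qed.
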